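(* Let $Q$ be a strong commutative semicartesian quantale. The full inclusion $i:\mathbf{ScottQSet}\hookrightarrow\mathbf{QSet}_f$ of the Scott-complete $Q$-sets (the right adjoint of the Scott completion functor) not only preserves limits but creates them.
   Context: A quantale is a complete lattice $(Q,\le)$ with an associative binary operation $\otimes$ that distributes over arbitrary suprema in each variable. It is commutative if $\otimes$ is commutative; semicartesian if $a\otimes b\le a\wedge b$ for all $a,b$; strong if for every $e\in Q$ with $e=e\otimes e$ and every $A\subseteq Q$, $e\le\bigvee_{a\in A}a$ implies $e\le\bigvee_{a\in A}a\otimes a$. A $Q$-set is a set $X$ with a map $\delta:X\times X\to Q$ such that for all $x,y,z$: $\delta(x,y)=\delta(y,x)$; $\delta(x,y)\otimes\delta(y,z)\le\delta(x,z)$; $\delta(x,x)\otimes\delta(x,y)=\delta(x,y)$. The extent of $x$ is $Ex:=\delta(x,x)$. $\mathbf{QSet}_f$ is the category of $Q$-sets with functional morphisms: functions $f:X\to Y$ with $\delta(x,x')\le\delta(f(x),f(x'))$ and $Ef(x)=Ex$, composed as functions. A singleton on $X$ is a map $\sigma:X\to Q$ such that for all $x,y\in X$: $\sigma(x)\otimes Ex=\sigma(x)$; $\sigma(x)\otimes\delta(x,y)\le\sigma(y)$; $\sigma(x)\otimes\sigma(y)\le\delta(x,y)$; $\sigma(x)\otimes\bigvee_{y\in X}\sigma(y)=\sigma(x)$. An element $x_\sigma\in X$ represents $\sigma$ if $\sigma(y)=\delta(y,x_\sigma)$ for all $y\in X$. $X$ is Scott-complete if every singleton on $X$ has exactly one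 representing element. $\mathbf{ScottQSet}$ is the full subcategory of $\mathbf{QSet}_f$ on Scott-complete $Q$-sets. The Scott completion functor $\mathfrak{S}:\mathbf{QSet}_f\to\mathbf{ScottQSet}$, left adjoint to $i$, sends $X$ to the set of singletons on $X$ with $\delta(\sigma,\xi)=\bigvee_{x\in X}\sigma(x)\otimes\xi(x)$, and a functional morphism $f:X\to Y$ to $\xi\mapsto\bigvee_{x\in X}\delta(f(x),-)\otimes\xi(x)$. *)

(* Defs.v *)
(* Stdlib only: relations, functional extensionality, proof irrelevance. *)
From Stdlib Require Import Relation_Definitions.
From Stdlib Require Import FunctionalExtensionality ProofIrrelevance.

Set Implicit Arguments.
Unset Strict Implicit.
Unset Printing Implicit Defensive.

(** * Quantales *)

Record complete_lattice := CompleteLattice {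
  cl_car :> Type;
  le : cl_car -> cl_car -> Prop;
  sup : (cl_car -> Prop) -> cl_car;
  inf : (cl_car -> Prop) -> cl_car;
  le_order : order cl_car le;
  sup_ub : forall (A : cl_car -> Prop) a, A a -> le a (sup A);
  sup_least : forall (A : cl_car -> Prop) b,
    (forall a, A a -> le a b) -> le (sup A) b;
  inf_lb : forall (A : cl_car -> Prop) a, A a -> le (inf A) a;
  inf_greatest : forall (A : cl_car -> Prop) b,
    (forall a, A a -> le b a) -> le b (inf A)
}.

Definition meet (L : complete_lattice) (a b : L) : L :=
  inf (fun c => c = a \/ c = b).

Definition sup_fam (L : complete_lattice) (I : Type) (f : I -> L) : L :=
  sup (fun q => exists i, q = f i).

Definition sup_over (L : complete_lattice) (A : L -> Prop) (f : L -> L) : L :=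
  sup (fun q => exists a, A a /\ q = f a).

(* No unit for the tensor is required. *)
Record quantale := Quantale {
  q_lat :> complete_lattice;
  tensor : q_lat -> q_lat -> q_lat;
  tensorA : forall a b c, tensor a (tensor b c) = tensor (tensor a b) c;
  tensor_sup_r : forall a (B : q_lat -> Prop),
    tensor a (sup B) = sup_over B (fun b => tensor a b);
  tensor_sup_l : forall (A : q_lat -> Prop) b,
    tensor (sup A) b = sup_over A (fun a => tensor a b)
}.

Declare Scope quantale_scope.
Delimit Scope quantale_scope with Q.
Infix "<=" := le : quantale_scope.
Infix "⊗" := tensor (at level 40, left associativity) : quantale_scope.
Local Open Scope quantale_scope.

Definition commutative_quantale (Q : quantale) : Prop :=
  forall a b : Q, a ⊗ b = b ⊗ a.

Definition semicartesian (Q : quantale) : Prop :=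
  forall a b : Q, a ⊗ b <= meet a b.

Definition strong (Q : quantale) : Prop :=
  forall (e : Q) (A : Q -> Prop),
    e = e ⊗ e -> e <= sup A -> e <= sup_over A (fun a => a ⊗ a).

(** * Categories, with Leibniz equality of morphisms *)

Record category := Category {
  ob :> Type;
  hom : ob -> ob -> Type;
  idm : forall x, hom x x;
  comp : forall x y z, hom y z -> hom x y -> hom x z;
  comp_idl : forall x y (f : hom x y), comp (idm y) f = f;
  comp_idr : forall x y (f : hom x y), comp f (idm x) = f;
  compA : forall x y z t (h : hom z t) (g : hom y z) (f : hom x y),
    comp h (comp g f) = comp (comp h g) f
}.

Record functor (C D : category) := Functor {
  fobj :> C -> D;
  fmap : forall x y : C, hom x y -> hom (fobj x) (fobj y);
  fmap_id : forall x, fmap (idm x) = idm (fobj x);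
  fmap_comp : forall (x y z : C) (g : hom y z) (f : hom x y),
    fmap (comp g f) = comp (fmap g) (fmap f)
}.

Lemma functor_comp_id (C D E : category) (G : functor D E) (F : functor C D)
  (x : C) : fmap G (fmap F (idm x)) = idm (G (F x)).
Proof. rewrite fmap_id; apply fmap_id. Qed.

Lemma functor_comp_comp (C D E : category) (G : functor D E) (F : functor C D)
  (x y z : C) (g : hom y z) (f : hom x y) :
  fmap G (fmap F (comp g f)) = comp (fmap G (fmap F g)) (fmap G (fmap F f)).
Proof. rewrite fmap_comp; apply fmap_comp. Qed.

Definition functor_comp (C D E : category) (G : functor D E) (F : functor C D)
  : functor C E :=
  {| fobj := fun x => G (F x);
     fmap := fun x y f => fmap G (fmap F f);
     fmap_id := functor_comp_id G F;
     fmap_comp := functor_comp_comp G F |}.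

Section FullSubcategory.
Variables (C : category) (P : C -> Prop).

Definition full_subcategory : category :=
  {| ob := {x : C | P x};
     hom := fun x y => hom (proj1_sig x) (proj1_sig y);
     idm := fun x => idm (proj1_sig x);
     comp := fun x y z g f => comp g f;
     comp_idl := fun x y f => comp_idl f;
     comp_idr := fun x y f => comp_idr f;
     compA := fun x y z t h g f => compA h g f |}.

Definition full_inclusion : functor full_subcategory C :=
  {| fobj := fun x : full_subcategory => proj1_sig x;
     fmap := fun (x y : full_subcategory) (f : hom x y) => f;
     fmap_id := fun x => eq_refl;
     fmap_comp := fun x y z g f => eq_refl |}.

End FullSubcategory.

Record cone (J C : category) (D : functor J C) := Cone {
  apex : C;
  leg : forall j, hom apex (D j);
  leg_nat : forall (j k : J) (u : hom j k), comp (fmap D u) (leg j) = leg k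
}.

Definition is_limit (J C : category) (D : functor J C) (c : cone D) : Prop :=
  forall c' : cone D,
    exists! u : hom (apex c') (apex c), forall j, comp (leg c j) u = leg c' j.

Lemma map_cone_nat (J C E : category) (F : functor C E) (D : functor J C)
  (c : cone D) (j k : J) (u : hom j k) :
  comp (fmap (functor_comp F D) u) (fmap F (leg c j)) = fmap F (leg c k).
Proof. simpl; rewrite <- fmap_comp, leg_nat; reflexivity. Qed.

Definition map_cone (J C E : category) (F : functor C E) (D : functor J C)
  (c : cone D) : cone (functor_comp F D) :=
  {| apex := F (apex c);
     leg := (fun j => fmap F (leg c j))
       : forall j, hom (F (apex c)) (functor_comp F D j);
     leg_nat := map_cone_nat F c |}.

Definition preserves_limits (C E : category) (F : functor C E) : Prop :=
  forall (J : category) (D : functor J C) (c : cone D),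
    is_limit c -> is_limit (map_cone F c).

(* Mac Lane's strict sense: each limiting cone over F∘D is, on the nose, the
   image of exactly one cone over D, and that cone is limiting. *)
Definition creates_limits (C E : category) (F : functor C E) : Prop :=
  forall (J : category) (D : functor J C) (t : cone (functor_comp F D)),
    is_limit t ->
    exists c : cone D,
      map_cone F c = t /\
      (forall c' : cone D, map_cone F c' = t -> c' = c) /\
      is_limit c.

(** * Q-sets *)

Section QSets.
Variable Q : quantale.

Record qset := QSet {
  qs_car :> Type;
  delta : qs_car -> qs_car -> Q;
  delta_sym : forall x y, delta x y = delta y x;
  delta_trans : forall x y z, delta x y ⊗ delta y z <= delta x z;
  delta_ext : forall x y, delta x x ⊗ delta x y = delta x y
}.

Definition extent (X : qset) (x : X) : Q := delta x x.

Record fmorphism (X Y : qset) := FMorphism {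
  fm_fun :> X -> Y;
  fm_delta : forall x x', delta x x' <= delta (fm_fun x) (fm_fun x');
  fm_extent : forall x, extent (fm_fun x) = extent x
}.

Lemma fmorphism_eq (X Y : qset) (f g : fmorphism X Y) :
  (forall x, f x = g x) -> f = g.
Proof.
destruct f as [f f1 f2], g as [g g1 g2]; simpl; intros E.
apply functional_extensionality in E; subst g.
f_equal; apply proof_irrelevance.
Qed.

Definition fm_id (X : qset) : fmorphism X X.
Proof.
refine {| fm_fun := fun x : X => x |}.
- intros x x'; destruct (le_order Q) as [refl _ _]; apply refl.
- reflexivity.
Defined.

Definition fm_comp (X Y Z : qset) (g : fmorphism Y Z) (f : fmorphism X Y) :
  fmorphism X Z.
Proof.
refine {| fm_fun := fun x => g (f x) |}.
- intros x x'; destruct (le_order Q) as [_ trans _].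
  apply trans with (delta (f x) (f x')); apply fm_delta.
- intros x; rewrite fm_extent; apply fm_extent.
Defined.

Definition QSetf : category.
Proof.
refine {| ob := qset; hom := fmorphism; idm := fm_id; comp := fm_comp |};
  intros; apply fmorphism_eq; reflexivity.
Defined.

Record singleton (X : qset) (s : X -> Q) : Prop := Singleton {
  sgl_extent : forall x, s x ⊗ extent x = s x;
  sgl_delta : forall x y, s x ⊗ delta x y <= s y;
  sgl_single : forall x y, s x ⊗ s y <= delta x y;
  sgl_sup : forall x, s x ⊗ sup_fam s = s x
}.

Definition represents (X : qset) (x : X) (s : X -> Q) : Prop :=
  forall y, s y = delta y x.

Definition scott_complete (X : qset) : Prop :=
  forall s : X -> Q, singleton s -> exists! x : X, represents x s.

Definition ScottQSet : category := full_subcategory (C := QSetf) scott_complete.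

Definition scott_inclusion : functor ScottQSet QSetf :=
  full_inclusion (C := QSetf) scott_complete.

End QSets.

(* Main.v *)
Require Import Defs.
From Stdlib Require Import FunctionalExtensionality ProofIrrelevance.
From Stdlib Require Import IndefiniteDescription.

(** The Scott-complete [Q]-sets form a reflective full subcategory, closed under
isomorphism, and every such inclusion preserves and creates limits.

Categorical half.  Let [e : X -> R] be the reflection of [X].  A cone with
vertex [X] over a diagram in the subcategory extends uniquely along [e] to a
cone with vertex [R].  Hence a cone that is limiting in the subcategory is
limiting in the whole category ([reflective_preserves_limits]).  If the vertex
[X] is itself that of a limiting cone, the extended cone yields [r : R -> X]; the
two universal properties force [r] and [e] to be mutually inverse, so [X] lies
in the subcategory ([reflective_limit_apex]), which is all that creation of
limits requires of a full inclusion.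

Quantale half.  The reflection of [X] is the [Q]-set of its singletons,
with [x] sent to [delta (-) x].  The distance from this image of [x] to a
singleton [s] is [s x] ([delta_eta]), and the extent of [s] is the supremum of
its values ([extent_completion]).  The latter is where strength enters: that
supremum is idempotent, so it lies below the supremum of the squares.  These two
formulas give completeness of the [Q]-set of singletons
([completion_scott_complete]).  They also show that a functional morphism [f] from
[X] to a Scott-complete [Y] has exactly one extension: the image of [s] must
represent the pushforward of [s] along [f]
([extension_represents], [completion_universal]). *)

Local Open Scope quantale_scope.

(** * Reflective subcategories and limits *)

Section Reflective.
Context {C : category} (P : C -> Prop).

Definition reflective : Prop :=
  forall X : C, exists (R : C) (e : hom X R), P R /\
    forall Y : C, P Y -> forall f : hom X Y, exists! g : hom R Y, comp g e = f.

Definition replete : Prop :=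
  forall (X Y : C) (f : hom X Y) (g : hom Y X),
    comp g f = idm X -> comp f g = idm Y -> P X -> P Y.

Hypothesis refl : reflective.

(** The extensions of the separate legs are again natural, because both sides of
each naturality equation extend the same morphism. *)
Lemma extend_cone (J : category) (D : functor J (full_subcategory P))
  (t : cone (functor_comp (full_inclusion P) D)) (R : C) (e : hom (apex t) R)
  (univ : forall Y : C, P Y -> forall f : hom (apex t) Y,
    exists! g : hom R Y, comp g e = f) :
  exists (l : forall j, hom R (proj1_sig (D j))),
    (forall j, comp (l j) e = leg t j) /\
    (forall (j k : J) (u : hom j k), comp (c := C) (fmap D u) (l j) = l k).
Proof.
assert (ex : forall j, exists g : hom R (proj1_sig (D j)), comp g e = leg t j).
{ intros j; destruct (univ _ (proj2_sig (D j)) (leg t j)) as [g [Hg _]].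
  exists g; exact Hg. }
exists (fun j => proj1_sig (constructive_indefinite_description _ (ex j))).
assert (Hl : forall j, comp
  (proj1_sig (constructive_indefinite_description _ (ex j))) e = leg t j).
{ intros j; exact (proj2_sig (constructive_indefinite_description _ (ex j))). }
split; [exact Hl|].
intros j k u.
destruct (univ _ (proj2_sig (D k)) (leg t k)) as [g [_ Hg]].
transitivity g; [symmetry|]; apply Hg; [|apply Hl].
rewrite <- compA.
transitivity (comp (c := C) (fmap D u) (leg t j)).
- f_equal; apply Hl.
- exact (leg_nat t u).
Qed.

Lemma reflective_preserves_limits : preserves_limits (full_inclusion P).
Proof.
intros J D c lim t.
destruct (refl (apex t)) as [R [e [PR univ]]].
destruct (extend_cone J D t R e univ) as [l [Hl Hn]].
pose (c' := {| apex := exist _ R PR : full_subcategory P;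
               leg := l; leg_nat := Hn |} : cone D).
destruct (lim c') as [u [Hu Uu]].
exists (comp (c := C) u e); split.
- intros j; simpl; rewrite compA.
  transitivity (comp (l j) e); [|apply Hl].
  exact (f_equal (fun h => comp (c := C) h e) (Hu j)).
- intros v Hv; simpl in *.
  (* [u] is only known to be unique among morphisms out of [R]; the target of
     [v] lies in [P], so [v] can be replaced by its factor through [e]. *)
  destruct (univ _ (proj2_sig (apex c)) v) as [w [Hw _]].
  rewrite <- Hw; f_equal; apply Uu.
  intros j.
  destruct (univ _ (proj2_sig (D j)) (leg t j)) as [g [_ Hg]].
  transitivity g; [symmetry|]; apply Hg; [|apply Hl].
  simpl; rewrite <- compA, Hw; apply Hv.
Qed.

Lemma reflective_limit_apex (rep : replete) (J : category)
  (D : functor J (full_subcategory P))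
  (t : cone (functor_comp (full_inclusion P) D)) :
  is_limit t -> P (apex t).
Proof.
intros lim.
destruct (refl (apex t)) as [R [e [PR univ]]].
destruct (extend_cone J D t R e univ) as [l [Hl Hn]].
destruct (lim {| apex := R;
  leg := l : forall j, hom R (functor_comp (full_inclusion P) D j);
  leg_nat := Hn |}) as [r [Hr _]]; simpl in *.
assert (re : comp r e = idm (apex t)).
{ destruct (lim t) as [i [_ Ui]].
  transitivity i; [symmetry|]; apply Ui; intros j.
  - rewrite compA; transitivity (comp (l j) e); [|apply Hl].
    exact (f_equal (fun h => comp (c := C) h e) (Hr j)).
  - apply comp_idr. }
apply (rep R (apex t) r e); [|exact re|exact PR].
destruct (univ _ PR e) as [g [_ Hg]].
transitivity g; [symmetry|]; apply Hg.
- rewrite <- compA, re; apply comp_idr.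
- apply comp_idl.
Qed.

Definition lift_cone (J : category) (D : functor J (full_subcategory P))
  (t : cone (functor_comp (full_inclusion P) D)) (p : P (apex t)) : cone D :=
  {| apex := exist _ (apex t) p : full_subcategory P;
     leg := leg t; leg_nat := leg_nat t |}.

Lemma map_lift_cone (J : category) (D : functor J (full_subcategory P))
  (t : cone (functor_comp (full_inclusion P) D)) (p : P (apex t)) :
  map_cone (full_inclusion P) (lift_cone J D t p) = t.
Proof.
destruct t as [X l n]; unfold map_cone, lift_cone; simpl.
f_equal; apply proof_irrelevance.
Qed.

Lemma lift_map_cone (J : category) (D : functor J (full_subcategory P))
  (c : cone D) (p : P (apex (map_cone (full_inclusion P) c))) :
  lift_cone J D (map_cone (full_inclusion P) c) p = c.
Proof.
destruct c as [[X q] l n]; simpl in p.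
assert (E : p = q) by apply proof_irrelevance; subst q.
unfold map_cone, lift_cone; simpl; f_equal; apply proof_irrelevance.
Qed.

Lemma reflective_creates_limits (rep : replete) :
  creates_limits (full_inclusion P).
Proof.
intros J D t lim.
pose proof (reflective_limit_apex rep J D t lim) as p.
exists (lift_cone J D t p); split; [apply map_lift_cone|split].
- intros c' E; subst t; symmetry; apply lift_map_cone.
- intros c'; exact (lim (map_cone (full_inclusion P) c')).
Qed.

End Reflective.

(** * Order and tensor calculus *)

Section Calculus.
Context {Q : quantale}.
Implicit Types a b c d : Q.

Lemma le_refl a : a <= a.
Proof. destruct (le_order Q) as [r _ _]; apply r. Qed.

Lemma le_trans a b c : a <= b -> b <= c -> a <= c.
Proof. destruct (le_order Q) as [_ t _]; apply t. Qed.

Lemma le_antisym a b : a <= b -> b <= a -> a = b.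
Proof. destruct (le_order Q) as [_ _ s]; apply s. Qed.

Lemma eq_le a b : a = b -> a <= b.
Proof. intros ->; apply le_refl. Qed.

Lemma fam_ub {I : Type} (f : I -> Q) i : f i <= sup_fam f.
Proof. apply sup_ub; exists i; reflexivity. Qed.

Lemma fam_least {I : Type} (f : I -> Q) b :
  (forall i, f i <= b) -> sup_fam f <= b.
Proof. intros H; apply sup_least; intros a [i ->]; apply H. Qed.

Lemma fam_mono {I : Type} (f g : I -> Q) :
  (forall i, f i <= g i) -> sup_fam f <= sup_fam g.
Proof.
intros H; apply fam_least; intros i.
apply le_trans with (g i); [apply H|apply (fam_ub g)].
Qed.

Lemma fam_ext {I : Type} (f g : I -> Q) :
  (forall i, f i = g i) -> sup_fam f = sup_fam g.
Proof.
intros H; apply le_antisym; apply fam_mono; intros i; apply eq_le;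
  [|symmetry]; apply H.
Qed.

Lemma tensor_fam_r {I : Type} a (f : I -> Q) :
  a ⊗ sup_fam f = sup_fam (fun i => a ⊗ f i).
Proof.
unfold sup_fam at 1; rewrite tensor_sup_r; apply le_antisym.
- apply sup_least; intros x [b [[i ->] ->]]; apply (fam_ub (fun i => a ⊗ f i)).
- apply fam_least; intros i; apply sup_ub; exists (f i); eauto.
Qed.

Hypothesis hcomm : commutative_quantale Q.

Lemma tensor_fam_l {I : Type} a (f : I -> Q) :
  sup_fam f ⊗ a = sup_fam (fun i => f i ⊗ a).
Proof.
rewrite hcomm, tensor_fam_r; apply fam_ext; intros i; apply hcomm.
Qed.

Lemma tensor_mono_r a b c : b <= c -> a ⊗ b <= a ⊗ c.
Proof.
intros H.
assert (E : c = sup_fam (fun i : bool => if i then b else c)).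
{ apply le_antisym.
  - apply (fam_ub (fun i : bool => if i then b else c) false).
  - apply fam_least; intros [|]; [exact H|apply le_refl]. }
rewrite E, tensor_fam_r.
apply (fam_ub (fun i : bool => a ⊗ (if i then b else c)) true).
Qed.

Lemma tensor_mono a b c d : a <= b -> c <= d -> a ⊗ c <= b ⊗ d.
Proof.
intros H K; apply le_trans with (a ⊗ d); [apply tensor_mono_r, K|].
rewrite (hcomm a), (hcomm b); apply tensor_mono_r, H.
Qed.

Lemma tensorAC a b c : a ⊗ b ⊗ c = a ⊗ c ⊗ b.
Proof. rewrite <- !tensorA; f_equal; apply hcomm. Qed.

Lemma tensorACA a b c d : (a ⊗ b) ⊗ (c ⊗ d) = (a ⊗ c) ⊗ (b ⊗ d).
Proof. rewrite !tensorA; f_equal; apply tensorAC. Qed.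

Hypothesis hsemi : semicartesian Q.

Lemma tensor_le_l a b : a ⊗ b <= a.
Proof.
apply le_trans with (meet a b); [apply hsemi|apply inf_lb; left; reflexivity].
Qed.

Lemma tensor_le_r a b : a ⊗ b <= b.
Proof. rewrite hcomm; apply tensor_le_l. Qed.

(** * Singletons *)

Section Singletons.
Context {X : qset Q}.

Lemma delta_ext_r (x y : X) : delta y x ⊗ delta x x = delta y x.
Proof. rewrite hcomm, (delta_sym y x); apply delta_ext. Qed.

Lemma delta_trans_mid (x y z : X) : delta y x ⊗ delta y z <= delta x z.
Proof. rewrite (delta_sym y x); apply delta_trans. Qed.

Lemma delta_le_extent (x y : X) : delta y x <= extent x.
Proof. rewrite <- delta_ext_r; apply tensor_le_r. Qed.

Lemma sup_delta (x : X) : sup_fam (fun y => delta y x) = extent x.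
Proof.
apply le_antisym.
- apply fam_least; intros y; apply delta_le_extent.
- apply (fam_ub (fun y => delta y x)).
Qed.

Lemma representable_singleton (x : X) : singleton (fun y => delta y x).
Proof.
split.
- intros y; rewrite hcomm; apply delta_ext.
- intros y z; rewrite hcomm, (delta_sym y z); apply delta_trans.
- intros y z; rewrite (delta_sym z x); apply delta_trans.
- intros y; rewrite sup_delta; apply delta_ext_r.
Qed.

Lemma sgl_sup_l (s : X -> Q) : singleton s -> forall x, sup_fam s ⊗ s x = s x.
Proof. intros hs x; rewrite hcomm; apply (sgl_sup hs). Qed.

Lemma sgl_sup_idem (s : X -> Q) : singleton s -> sup_fam s = sup_fam s ⊗ sup_fam s.
Proof.
intros hs; rewrite tensor_fam_r; apply fam_ext; intros x.
symmetry; apply (sgl_sup_l s hs).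
Qed.

Hypothesis hstrong : strong Q.

(** The supremum of a singleton is idempotent, so strength applies to it. *)
Lemma sgl_sup_squares (s : X -> Q) :
  singleton s -> sup_fam (fun x => s x ⊗ s x) = sup_fam s.
Proof.
intros hs; apply le_antisym.
- apply fam_mono; intros x; apply tensor_le_l.
- eapply le_trans;
    [exact (hstrong _ _ (sgl_sup_idem s hs) (le_refl _))|].
  apply sup_least; intros a [b [[x ->] ->]].
  apply (fam_ub (fun x => s x ⊗ s x)).
Qed.

End Singletons.

(** * The Scott completion *)

Section Completion.
Hypothesis hstrong : strong Q.

Section Object.
Variable X : qset Q.

Definition sgl_type : Type := {s : X -> Q | singleton s}.

Definition sgl_delta_fun (s t : sgl_type) : Q :=
  sup_fam (fun x => proj1_sig s x ⊗ proj1_sig t x).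

Lemma sgl_type_eq (s t : sgl_type) :
  (forall x, proj1_sig s x = proj1_sig t x) -> s = t.
Proof.
destruct s as [s hs], t as [t ht]; simpl; intros E.
apply functional_extensionality in E; subst t; f_equal; apply proof_irrelevance.
Qed.

Lemma sgl_delta_fun_sym s t : sgl_delta_fun s t = sgl_delta_fun t s.
Proof. apply fam_ext; intros x; apply hcomm. Qed.

Lemma sgl_delta_fun_trans s t u :
  sgl_delta_fun s t ⊗ sgl_delta_fun t u <= sgl_delta_fun s u.
Proof.
unfold sgl_delta_fun.
destruct s as [s hs], t as [t ht], u as [u hu]; simpl.
rewrite tensor_fam_l; apply fam_least; intros x.
rewrite tensor_fam_r; apply fam_least; intros y.
eapply le_trans; [|apply (fam_ub (fun x => s x ⊗ u x) y)].
rewrite tensorA; apply tensor_mono; [|apply le_refl].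
eapply le_trans; [|apply (sgl_delta hs x)].
rewrite <- tensorA; apply tensor_mono_r, (sgl_single ht).
Qed.

Lemma sgl_delta_fun_ext s t :
  sgl_delta_fun s s ⊗ sgl_delta_fun s t = sgl_delta_fun s t.
Proof.
unfold sgl_delta_fun; destruct s as [s hs], t as [t ht]; simpl.
rewrite (sgl_sup_squares hstrong s hs), tensor_fam_r; apply fam_ext; intros x.
rewrite tensorA; f_equal; apply (sgl_sup_l s hs).
Qed.

Definition completion : qset Q :=
  {| qs_car := sgl_type;
     delta := sgl_delta_fun;
     delta_sym := sgl_delta_fun_sym;
     delta_trans := sgl_delta_fun_trans;
     delta_ext := sgl_delta_fun_ext |}.

Lemma extent_completion (s : completion) :
  extent s = sup_fam (proj1_sig s).
Proof. exact (sgl_sup_squares hstrong _ (proj2_sig s)). Qed.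

Definition eta_fun (x : X) : completion :=
  exist _ (fun y => delta y x) (representable_singleton x).

(** The analogue of the Yoneda lemma. *)
Lemma delta_eta (x : X) (s : completion) : delta (eta_fun x) s = proj1_sig s x.
Proof.
destruct s as [s hs]; apply le_antisym; simpl.
- apply fam_least; intros y; simpl.
  rewrite hcomm; apply (sgl_delta hs).
- eapply le_trans; [|apply (fam_ub (fun y => delta y x ⊗ s y) x)].
  rewrite hcomm; apply eq_le; symmetry; apply (sgl_extent hs).
Qed.

Definition eta : fmorphism X completion.
Proof.
refine {| fm_fun := eta_fun |}.
- intros x y; rewrite delta_eta; apply le_refl.
- intros x; unfold extent at 1; rewrite delta_eta; reflexivity.
Defined.

(** A singleton [S] on the completion is represented by its restriction along
[eta].  Indeed [S s] is unchanged by tensoring with the extent of [s], that is,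
with the supremum of the squares of the values [s x], and [s x] is the distance
between [eta x] and [s]: one factor carries [S s] to [S (eta x)], the other is
kept as the distance. *)
Lemma completion_scott_complete : scott_complete completion.
Proof.
intros S hS.
assert (Esup : sup_fam (fun x => S (eta x)) = sup_fam S).
{ apply le_antisym.
  - apply fam_least; intros x; apply fam_ub.
  - apply fam_least; intros s.
    rewrite <- (sgl_extent hS), extent_completion, tensor_fam_r.
    apply fam_mono; intros x; rewrite <- delta_eta, delta_sym.
    apply (sgl_delta hS). }
assert (hr : singleton (fun x => S (eta x))).
{ split.
  - intros x; rewrite <- (fm_extent eta); apply (sgl_extent hS).
  - intros x y; eapply le_trans; [|apply (sgl_delta hS (eta x) (eta y))].
    apply tensor_mono_r, fm_delta.
  - intros x y; eapply le_trans; [apply (sgl_single hS)|].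
    simpl (fm_fun _ _); rewrite delta_eta; apply le_refl.
  - intros x; rewrite Esup; apply (sgl_sup hS). }
exists (exist _ _ hr : completion); split.
- intros s; apply le_antisym.
  + rewrite <- (sgl_extent hS); change (extent s)
      with (sup_fam (fun x => proj1_sig s x ⊗ proj1_sig s x)).
    rewrite tensor_fam_r; apply fam_mono; intros x; simpl.
    rewrite tensorA, hcomm; apply tensor_mono_r.
    rewrite <- delta_eta, delta_sym; apply (sgl_delta hS).
  + apply fam_least; intros x; simpl.
    rewrite hcomm, <- delta_eta; apply (sgl_delta hS).
- intros t Ht; apply sgl_type_eq; intros x; simpl.
  rewrite <- delta_eta; apply Ht.
Qed.

End Object.

(** * Extending morphisms to the completion *)

Section Extension.
Context {X Y : qset Q} (f : fmorphism X Y).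

Definition pushforward (s : X -> Q) (y : Y) : Q :=
  sup_fam (fun x => delta (f x) y ⊗ s x).

Lemma le_pushforward (s : X -> Q) : singleton s ->
  forall x, s x <= pushforward s (f x).
Proof.
intros hs x; eapply le_trans;
  [|apply (fam_ub (fun x' => delta (f x') (f x) ⊗ s x') x)]; simpl.
change (delta (f x) (f x)) with (extent (f x)).
rewrite fm_extent, hcomm; apply eq_le; symmetry; apply (sgl_extent hs).
Qed.

Lemma sup_pushforward (s : X -> Q) :
  singleton s -> sup_fam (pushforward s) = sup_fam s.
Proof.
intros hs; apply le_antisym.
- apply fam_least; intros y; apply fam_mono; intros x; apply tensor_le_r.
- apply fam_least; intros x; eapply le_trans; [apply (le_pushforward s hs)|].
  apply fam_ub.
Qed.

Lemma pushforward_singleton (s : X -> Q) :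
  singleton s -> singleton (pushforward s).
Proof.
intros hs; split.
- intros y; unfold pushforward at 1; rewrite tensor_fam_l.
  apply fam_ext; intros x; rewrite tensorAC; f_equal; apply delta_ext_r.
- intros y z; unfold pushforward; rewrite tensor_fam_l.
  apply fam_mono; intros x; rewrite tensorAC.
  apply tensor_mono; [apply delta_trans|apply le_refl].
- intros y z; unfold pushforward; rewrite tensor_fam_l.
  apply fam_least; intros x; rewrite tensor_fam_r; apply fam_least; intros x'.
  (* go from [y] to [z] through [f x] and [f x'] *)
  rewrite tensorACA.
  apply le_trans with (delta (f x) y ⊗ delta (f x') z ⊗ delta (f x) (f x')).
  + apply tensor_mono_r; eapply le_trans;
      [apply (sgl_single hs)|apply fm_delta].
  + rewrite tensorAC; eapply le_trans; [|apply (delta_trans y (f x') z)].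
    apply tensor_mono; [apply delta_trans_mid|apply le_refl].
- intros y; rewrite (sup_pushforward s hs); unfold pushforward.
  rewrite tensor_fam_l; apply fam_ext; intros x.
  rewrite <- tensorA; f_equal; apply (sgl_sup hs).
Qed.

(** An extension of [f] along [eta] has no freedom: at [s] its value represents
the pushforward of [s].  For the upper bound, the extent of [g s] is that of
[s], a supremum of squares: one factor [s x] measures how close [f x] is to
[g s], the other survives in the pushforward. *)
Lemma extension_represents (g : fmorphism (completion X) Y)
  (hg : forall x, g (eta X x) = f x) (s : completion X) :
  represents (g s) (pushforward (proj1_sig s)).
Proof.
assert (K : forall x, proj1_sig s x <= delta (f x) (g s)).
{ intros x; rewrite <- delta_eta, <- hg; apply (fm_delta g (eta X x) s). }
intros y; apply le_antisym.
- apply fam_least; intros x.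
  eapply le_trans; [apply tensor_mono_r, K|apply delta_trans_mid].
- rewrite <- delta_ext_r; change (delta (g s) (g s)) with (extent (g s)).
  rewrite fm_extent; change (extent s)
    with (sup_fam (fun x => proj1_sig s x ⊗ proj1_sig s x)).
  rewrite tensor_fam_r; apply fam_mono; intros x; rewrite tensorA.
  apply tensor_mono; [|apply le_refl].
  eapply le_trans; [apply tensor_mono_r, K|].
  rewrite hcomm, (delta_sym y); apply delta_trans.
Qed.

(** So a map that sends each singleton to an element representing its
pushforward does extend [f], as soon as such elements are unique in [Y]. *)
Lemma pushforward_eta (x : X) (y : Y) :
  pushforward (proj1_sig (eta X x)) y = delta y (f x).
Proof.
rewrite (delta_sym y); apply le_antisym.
- apply fam_least; intros x'; simpl.
  eapply le_trans; [apply tensor_mono_r, (fm_delta f)|].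
  rewrite hcomm, (delta_sym (f x')); apply delta_trans.
- eapply le_trans;
    [|apply (fam_ub (fun x' => delta (f x') y ⊗ delta x' x) x)]; simpl.
  change (delta x x) with (extent x).
  rewrite <- (fm_extent f), hcomm; apply eq_le; symmetry; apply delta_ext.
Qed.

Lemma represents_pushforward_fmorphism (g : completion X -> Y)
  (hg : forall s, represents (g s) (pushforward (proj1_sig s))) :
  exists g' : fmorphism (completion X) Y, forall s, g' s = g s.
Proof.
unshelve eexists {| fm_fun := g |}; [| |reflexivity].
- intros s t; apply fam_least; intros x.
  apply le_trans with (delta (f x) (g s) ⊗ delta (f x) (g t));
    [|apply delta_trans_mid].
  rewrite <- !hg; apply tensor_mono; apply le_pushforward;
    [exact (proj2_sig s)|exact (proj2_sig t)].
- intros s; rewrite extent_completion, <- sup_pushforward, <- sup_delta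
    by exact (proj2_sig s).
  apply fam_ext; intros y; symmetry; apply hg.
Qed.

Lemma completion_universal : scott_complete Y ->
  exists! g : fmorphism (completion X) Y, fm_comp g (eta X) = f.
Proof.
intros hY.
assert (R : forall s : completion X,
  exists y : Y, represents y (pushforward (proj1_sig s))).
{ intros s.
  destruct (hY _ (pushforward_singleton _ (proj2_sig s))) as [y [Hy _]].
  exists y; exact Hy. }
apply functional_choice in R; destruct R as [g0 Hg0].
destruct (represents_pushforward_fmorphism g0 Hg0) as [g Hg].
assert (U : forall (s : completion X) (y y' : Y),
  represents y (pushforward (proj1_sig s)) ->
  represents y' (pushforward (proj1_sig s)) -> y = y').
{ intros s y y' Hy Hy'.
  destruct (hY _ (pushforward_singleton _ (proj2_sig s))) as [z [_ Hz]].
  rewrite <- (Hz y Hy); apply Hz, Hy'. }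
exists g; split.
- apply fmorphism_eq; intros x; apply (U (eta X x)).
  + simpl; rewrite Hg; apply Hg0.
  + intros y; apply pushforward_eta.
- intros h Hh; apply fmorphism_eq; intros s; apply (U s).
  + rewrite Hg; apply Hg0.
  + apply extension_represents; intros x; rewrite <- Hh; reflexivity.
Qed.

End Extension.

Lemma scott_reflective : reflective (C := QSetf Q) (@scott_complete Q).
Proof.
intros X; exists (completion X), (eta X); split.
- apply completion_scott_complete.
- intros Y hY f; exact (completion_universal f hY).
Qed.

End Completion.
End Calculus.

Lemma fmorphism_inverse_delta {Q : quantale} {X Y : qset Q}
  (f : fmorphism X Y) (g : fmorphism Y X) (gf : forall x, g (f x) = x)
  (fg : forall y, f (g y) = y) (x : X) (y : Y) : delta (g y) x = delta y (f x).
Proof.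
apply le_antisym.
- rewrite <- (fg y) at 2; apply fm_delta.
- rewrite <- (gf x) at 2; apply fm_delta.
Qed.

Lemma scott_replete (Q : quantale) :
  replete (C := QSetf Q) (@scott_complete Q).
Proof.
intros X Y f g Egf Efg hX s hs.
assert (gf : forall x, g (f x) = x)
  by (intros x; exact (f_equal (fun h : fmorphism X X => h x) Egf)).
assert (fg : forall y, f (g y) = y)
  by (intros y; exact (f_equal (fun h : fmorphism Y Y => h y) Efg)).
assert (fd : forall x x', delta (f x) (f x') = delta x x').
{ intros x x'; rewrite <- (fmorphism_inverse_delta f g gf fg), gf; reflexivity. }
assert (Esup : sup_fam (fun x => s (f x)) = sup_fam s).
{ apply le_antisym; apply fam_least.
  - intros x; apply fam_ub.
  - intros y; rewrite <- (fg y); apply (fam_ub (fun x => s (f x))). }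
assert (hr : singleton (fun x => s (f x))).
{ split.
  - intros x; rewrite <- (fm_extent f); apply (sgl_extent hs).
  - intros x x'; rewrite <- fd; apply (sgl_delta hs).
  - intros x x'; rewrite <- fd; apply (sgl_single hs).
  - intros x; rewrite Esup; apply (sgl_sup hs). }
destruct (hX _ hr) as [x [Hx Ux]].
exists (f x); split.
- intros y; rewrite <- (fmorphism_inverse_delta f g gf fg), <- Hx, fg.
  reflexivity.
- intros y Hy; rewrite (Ux (g y)); [apply fg|].
  intros x'; rewrite Hy, delta_sym, <- (fmorphism_inverse_delta f g gf fg).
  apply delta_sym.
Qed.

Theorem mainTheorem10 (Q : quantale) (hcomm : commutative_quantale Q)
  (hsemi : semicartesian Q) (hstrong : strong Q) :
  preserves_limits (scott_inclusion Q) /\ creates_limits (scott_inclusion Q).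
Proof.
pose proof (scott_reflective hcomm hsemi hstrong) as refl.
split.
- exact (reflective_preserves_limits _ refl).
- exact (reflective_creates_limits _ refl (@scott_replete Q)).
Qed.
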